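(* Let $\Phi:\mathcal D\to\mathcal D$ be a unital completely positive map satisfying $\Phi(BDB^{-1})=B\Phi(D)B^{-1}$ for all $D\in\mathcal D$. Then there is a well-defined unital completely positive map $\Gamma: B(\ell^2(\mathbb Z))\to B(\ell^2(\mathbb Z))$ which is a bimodule map over the Laurent matrices and satisfies $\Gamma\big(\sum_{n\in\mathbb Z}D_nB^n\big)=\sum_{n\in\mathbb Z}\Phi(D_n)B^n$ in the sense of formal Fourier series, i.e. $\widehat{\Gamma(A)}(n)=\Phi(\hat A(n))$ for all $A$ and $n$. Moreover, if $\Phi$ is idempotent, then $\Gamma$ is idempotent.
   Context: $\{e_n\}_{n\in\mathbb Z}$ is the standard basis of $\ell^2(\mathbb Z)$ and $B$ is the bilateral shift $Be_n=e_{n+1}$. $\mathcal D\subseteq B(\ell^2(\mathbb Z))$ is the algebra of bounded diagonal operators (identified with $\ell^\infty(\mathbb Z)$), and $E:B(\ell^2(\mathbb Z))\to\mathcal D$ is the map keeping the diagonal entries of a matrix. For $A\in B(\ell^2(\mathbb Z))$, $\hat A(n)=E(AB^{-n})\in\mathcal D$, and $\sum_n\hat A(n)B^n$ is its formal Fourier series, which uniquely determines $A$. The Laurent matrices are the operators with matrix entries $a_{i,j}=\hat f(i-j)$ for $f\in L^\infty(\mathbb T)$; under $\ell^2(\mathbb Z)\cong L^2(\mathbb T)$, $e_n\mapsto z^n$, they are the multiplication operators by $L^\infty(\mathbb T)$ (''$L^\infty$-bimodule map''). *)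

(* Defs.v *)
From HB Require Import structures.
From mathcomp Require Import all_boot all_order all_algebra.
From mathcomp Require Import all_classical all_reals all_analysis.
From mathcomp.real_closed Require Import complex.
Set Implicit Arguments. Unset Strict Implicit. Unset Printing Implicit Defensive.
Import Order.TTheory GRing.Theory Num.Theory.
Import numFieldNormedType.Exports.
Local Open Scope ring_scope.
Local Open Scope complex_scope.

Section Defs.
Variable R : realType.
Local Notation C := R[i].

(* A vector / sequence indexed by Z, and an (infinite) matrix w.r.t. the basis (e_n) of l^2(Z):
   A i j = <A e_j, e_i>. *)
Definition seqZ := int -> C.
Definition op := int -> int -> C.

Definition wsum (N : nat) (F : int -> C) : C :=
  \sum_(k < (2 * N).+1) F (k%:Z - N%:Z).

(* <x, A y> for x, y supported in [-N, N] *)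
Definition inner (N : nat) (x : seqZ) (A : op) (y : seqZ) : C :=
  wsum N (fun i => wsum N (fun j => (x i)^* * A i j * y j)).

Definition nrm2 (N : nat) (x : seqZ) : C := wsum N (fun i => (x i)^* * x i).

Definition bounded_op (A : op) : Prop :=
  exists M : C, forall (N : nat) (x y : seqZ),
    `|inner N x A y| ^+ 2 <= M * nrm2 N x * nrm2 N y.

Definition block_pos (n : nat) (A : 'I_n -> 'I_n -> op) : Prop :=
  forall (N : nat) (x : 'I_n -> seqZ),
    0 <= \sum_(k < n) \sum_(l < n) inner N (x k) (A k l) (x l).

Definition id_op : op := fun i j => if i == j then 1 else 0.

Definition add_op (a : C) (A B : op) : op := fun i j => a * A i j + B i j.

Definition csumZ (F : int -> C) : C :=
  Complex (limn (fun N : nat => complex.Re (wsum N F) : R)) (limn (fun N : nat => complex.Im (wsum N F) : R)).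

Definition mul_op (A B : op) : op := fun i j => csumZ (fun k => A i k * B k j).

Definition ucp_op (G : op -> op) : Prop :=
  [/\ (forall A, bounded_op A -> bounded_op (G A)),
      (forall a A B, bounded_op A -> bounded_op B ->
          G (add_op a A B) = add_op a (G A) (G B)),
      G id_op = id_op &
      (forall n (A : 'I_n -> 'I_n -> op), (forall k l, bounded_op (A k l)) ->
          block_pos A -> block_pos (fun k l => G (A k l)))].

Definition bounded_seq (d : seqZ) : Prop := exists M : C, forall i, `|d i| <= M.
Definition diag (d : seqZ) : op := fun i j => if i == j then d i else 0.
Definition one_seq : seqZ := fun _ => 1.
Definition add_seq (a : C) (d e : seqZ) : seqZ := fun i => a * d i + e i.

Definition ucp_diag (Phi : seqZ -> seqZ) : Prop :=
  [/\ (forall d, bounded_seq d -> bounded_seq (Phi d)),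
      (forall a d e, bounded_seq d -> bounded_seq e ->
          Phi (add_seq a d e) = add_seq a (Phi d) (Phi e)),
      Phi one_seq = one_seq &
      (forall n (d : 'I_n -> 'I_n -> seqZ), (forall k l, bounded_seq (d k l)) ->
          block_pos (fun k l => diag (d k l)) ->
          block_pos (fun k l => diag (Phi (d k l))))].

(* B D B^{-1} for D = diag d: (B D B^{-1}) e_n = d_{n-1} e_n *)
Definition conjB (d : seqZ) : seqZ := fun i => d (i - 1).

(* \hat A(n) = E(A B^{-n}), whose i-th diagonal entry is A_{i, i-n} *)
Definition fourier (A : op) (n : int) : seqZ := fun i => A i (i - n).

(* Laurent matrices: bounded matrices constant along diagonals, a_{ij} = c(i-j)
   (equivalently: the bounded operators commuting with B = multiplication operators by L^infty(T)). *)
Definition laurent (L : op) : Prop :=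
  bounded_op L /\ forall i j, L (i + 1) (j + 1) = L i j.

End Defs.

(* Main.v *)
(* By equivariance, [Phi d i = phi (m |-> d (m + i))] for the state [phi d := Phi d 0] of
   [l^infty(Z)], so the map with the prescribed Fourier coefficients is
   [Gamma A i j = phi (m |-> A (m + i) (m + j))]: a [phi]-average of the conjugates
   [B^(-m) A B^m].  Complete positivity and boundedness are inherited from these
   conjugates because [phi] is positive, and idempotence is read off the Fourier
   coefficients.  Laurent matrices are fixed by the conjugations, so the bimodule property
   amounts to moving [phi] inside [sum_k L i k * A (m + k) (m + j)]; although [phi] need
   not be normal, this is legitimate because row [i] of [L] is in l^2 and the columns of
   [A] are uniformly bounded in l^2, so that the series converges uniformly in [m]. *)
Require Import Defs.
From HB Require Import structures.
From mathcomp Require Import all_boot all_order all_algebra.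
From mathcomp Require Import all_classical all_reals all_analysis.
From mathcomp.real_closed Require Import complex.
From mathcomp Require Import zify ring.
Set Implicit Arguments. Unset Strict Implicit. Unset Printing Implicit Defensive.
Import Order.TTheory GRing.Theory Num.Theory.
Import numFieldNormedType.Exports.
Local Open Scope ring_scope.

(** * Finite windows of integers, with elementary real estimates *)

Definition window (N : nat) : seq int := [seq k%:Z - N%:Z | k <- iota 0 (2 * N).+1].

Lemma mem_window N k : (k \in window N) = (absz k <= N)%N.
Proof.
apply/mapP/idP => [[m]|kN]; first by rewrite mem_iota => ? ->; lia.
by exists (absz (k + N%:Z)); rewrite ?mem_iota; lia.
Qed.

Lemma uniq_window N : uniq (window N).
Proof. by rewrite map_inj_uniq ?iota_uniq // => i j; lia. Qed.

Lemma sub_window (S : seq int) : exists N, {subset S <= window N}.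
Proof.
elim: S => [|k S [N SN]]; first by exists 0%N.
exists (maxn (absz k) N) => i; rewrite inE => /orP[/eqP->|/SN]; rewrite !mem_window; lia.
Qed.

Lemma sub_windows N K : (N <= K)%N -> {subset window N <= window K}.
Proof. by move=> NK k; rewrite !mem_window; lia. Qed.

Lemma big_sub_uniq (V : zmodType) (S T : seq int) (F : int -> V) :
  uniq S -> uniq T -> {subset S <= T} ->
  \sum_(k <- T) (if k \in S then F k else 0) = \sum_(k <- S) F k.
Proof.
move=> uS uT ST; rewrite -big_mkcond -big_filter; apply: perm_big.
apply: uniq_perm => //; first exact: filter_uniq.
by move=> k; rewrite mem_filter; case kS: (k \in S) => //=; rewrite ST.
Qed.

Lemma big_sub_diff (V : zmodType) (S T : seq int) (F : int -> V) :
  uniq S -> uniq T -> {subset S <= T} ->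
  \sum_(k <- T) F k = \sum_(k <- S) F k + \sum_(k <- [seq k <- T | k \notin S]) F k.
Proof.
move=> uS uT ST; rewrite (bigID (mem S)) /= big_filter; congr (_ + _).
rewrite -big_filter; apply: perm_big; apply: uniq_perm => //; first exact: filter_uniq.
by move=> k; rewrite mem_filter /=; case kS: (k \in S) => //=; rewrite ST.
Qed.

(** [limn] carries information only for a convergent sequence, so completeness of the reals has to
    supply convergence before the limit can be estimated. *)
Lemma limn_cauchy (R : realType) (u : nat -> R) :
  (forall e, 0 < e -> exists K, forall N, (K <= N)%N -> `|u N - u K| <= e) ->
  forall e, 0 < e -> exists K, forall N, (K <= N)%N -> `|u N - limn u| <= e.
Proof.
move=> cu e e0.
have ucvg : cvgn u.
  apply/cauchy_cvgP/cauchy_exP => d d0.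
  have [K uK] := cu (d / 2) (divr_gt0 d0 (ltr0Sn _ 1)).
  exists (u K); exists K => // N /= KN.
  rewrite /ball /= distrC; apply: le_lt_trans (uK _ KN) _.
  by rewrite ltr_pdivrMr // ltr_pMr // ltr1n.
move/cvgrPdist_le: ucvg => /(_ e e0)[K _ uK]; exists K => N KN.
by rewrite distrC; apply: uK.
Qed.

(** The right side equals [2ab] plus the square [t^-1 (ta - b)^2]. The free weight [t] lets one
    factor be made cheap at the expense of the other. *)
Lemma mul_le_weighted_squares (F : numFieldType) (t a b : F) :
  0 < t -> 0 <= a -> 0 <= b -> a * b <= t * a ^+ 2 + t^-1 * b ^+ 2.
Proof.
move=> t0 a0 b0; have tn0 : t != 0 by rewrite gt_eqF.
have sq : 0 <= t^-1 * (t * a - b) ^+ 2.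
  apply: mulr_ge0; first by rewrite invr_ge0 ltW.
  apply: real_exprn_even_ge0 => //.
  by rewrite rpredB ?rpredM // ?ger0_real // ltW.
have -> : t * a ^+ 2 + t^-1 * b ^+ 2 = a * b + (t^-1 * (t * a - b) ^+ 2 + a * b) by field.
by rewrite lerDl addr_ge0 // mulr_ge0.
Qed.

(** * Unconditional summation over the integers, and l^2 sequences *)

Section Summation.
Local Open Scope complex_scope.
Variable R : realType.
Local Notation C := R[i].
Local Notation Re := (@complex.Re R).
Local Notation Im := (@complex.Im R).

Lemma wsumE N (F : int -> C) : wsum N F = \sum_(k <- window N) F k.
Proof. by rewrite /wsum -(big_mkord xpredT (fun k : nat => F (k%:Z - N%:Z))) big_map /index_iota subn0. Qed.

Lemma le_normRe (z : C) : (`|Re z|)%:C <= `|z|.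
Proof. by rewrite normc_def lecR -sqrtr_sqr ler_wsqrtr // lerDl sqr_ge0. Qed.

Lemma le_normIm (z : C) : (`|Im z|)%:C <= `|z|.
Proof. by rewrite normc_def lecR -sqrtr_sqr ler_wsqrtr // lerDr sqr_ge0. Qed.

Lemma norm_leReIm (z : C) : `|z| <= (`|Re z|)%:C + (`|Im z|)%:C.
Proof.
rewrite {1}[z]complexE; apply: le_trans (ler_normD _ _) _.
rewrite normrM !normc_def /= !expr0n /= !addr0 !add0r !expr1n !sqrtr1 mul1r.
by rewrite !sqrtr_sqr.
Qed.

Lemma complex_gt0 (e : C) : 0 < e -> exists2 d : R, 0 < d & e = d%:C.
Proof. by case: e => a b; rewrite ltcE /= => /andP[/eqP-> a0]; exists a. Qed.

(** [s] copies the shape of [csumZ], which takes limits of real and imaginary parts separately; each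
    part inherits the Cauchy estimate from [f]. *)
Lemma complex_cauchy (f : nat -> C) :
  (forall e : C, 0 < e -> exists K, forall N, (K <= N)%N -> `|f N - f K| <= e) ->
  let s := Complex (limn (fun N => Re (f N) : R)) (limn (fun N => Im (f N) : R)) in
  forall e : C, 0 < e -> exists K, forall N, (K <= N)%N -> `|f N - s| <= e.
Proof.
move=> cf s _ /complex_gt0[e e0 ->].
have e2 : 0 < e / 2 by rewrite divr_gt0.
have ReB (x y : C) : Re (x - y) = Re x - Re y by case: x y => [? ?] [].
have ImB (x y : C) : Im (x - y) = Im x - Im y by case: x y => [? ?] [].
have [K1 h1] : exists K, forall N, (K <= N)%N -> `|Re (f N) - Re s| <= e / 2.
  apply: limn_cauchy e2 => d d0; have [|K cK] := cf d%:C; first by rewrite ltcR.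
  by exists K => N /cK h; rewrite -ReB -lecR (le_trans (le_normRe _)).
have [K2 h2] : exists K, forall N, (K <= N)%N -> `|Im (f N) - Im s| <= e / 2.
  apply: limn_cauchy e2 => d d0; have [|K cK] := cf d%:C; first by rewrite ltcR.
  by exists K => N /cK h; rewrite -ImB -lecR (le_trans (le_normIm _)).
exists (maxn K1 K2) => N; rewrite geq_max => /andP[/h1 N1 /h2 N2].
apply: le_trans (norm_leReIm _) _.
by rewrite ReB ImB -rmorphD lecR [leRHS](splitr e) lerD.
Qed.

(** Arbitrary finite sets off the window are allowed, not only larger windows. This encodes
    unconditional convergence, which survives translation of the index although [csumZ] is a limit
    of symmetric sums. *)
Definition small_tail (F : int -> C) (K : nat) (e : C) : Prop :=
  forall T, uniq T -> {in T, forall k, k \notin window K} -> `|\sum_(k <- T) F k| <= e.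

Definition summable_Z (F : int -> C) : Prop :=
  forall e, 0 < e -> exists K, small_tail F K e.

Lemma small_tail_diff F K e S T : small_tail F K e -> uniq S -> uniq T ->
  {subset window K <= S} -> {subset S <= T} ->
  `|\sum_(k <- T) F k - \sum_(k <- S) F k| <= e.
Proof.
move=> tF uS uT KS ST; rewrite (big_sub_diff _ uS uT ST) addrC addKr.
apply: tF; first exact: filter_uniq.
by move=> k; rewrite mem_filter => /andP[kS _]; apply: contra kS; apply: KS.
Qed.

Lemma csumZ_approx F K e S : summable_Z F -> small_tail F K e -> uniq S ->
  {subset window K <= S} -> `|\sum_(k <- S) F k - csumZ F| <= e.
Proof.
move=> sF tF uS KS; apply/ler_addgt0Pr => d d0.
have [K' cK'] : exists K, forall N, (K <= N)%N -> `|wsum N F - csumZ F| <= d.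
  apply: complex_cauchy d0 => d' /sF[K0 tK0]; exists K0 => N K0N.
  by rewrite !wsumE; apply: small_tail_diff tK0 _ _ _ _; rewrite ?uniq_window //;
     apply: sub_windows.
(* A window containing [S] and lying beyond [K'] is close both to the sum over [S] and to
   [csumZ F]. *)
have [M SM] := sub_window S.
have K'N : (K' <= maxn K' M)%N by lia.
rewrite -(subrKA (wsum (maxn K' M) F)); apply: le_trans (ler_normD _ _) _.
apply: lerD (cK' _ K'N); rewrite distrC wsumE.
apply: small_tail_diff tF uS (uniq_window _) KS _ => k /SM.
by apply: sub_windows; lia.
Qed.

Lemma csumZ_eq F s : summable_Z F ->
  (forall e, 0 < e -> exists K, forall S, uniq S -> {subset window K <= S} ->
     `|\sum_(k <- S) F k - s| <= e) -> csumZ F = s.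
Proof.
move=> sF cs; apply/eqP; rewrite -subr_eq0 -normr_le0.
apply/ler_addgt0Pr => e e0; rewrite add0r.
have e2 : 0 < e / 2 by rewrite divr_gt0.
have [K1 t1] := sF _ e2; have [K2 h2] := cs _ e2.
rewrite (splitr e) -(subrKA (\sum_(k <- window (maxn K1 K2)) F k)).
apply: le_trans (ler_normD _ _) _; apply: lerD; last first.
  by apply: h2; [exact: uniq_window | apply: sub_windows; lia].
rewrite distrC; apply: csumZ_approx sF t1 (uniq_window _) _.
by apply: sub_windows; lia.
Qed.

Lemma csumZ_shift F m : summable_Z F -> csumZ (fun k => F (m + k)) = csumZ F.
Proof.
move=> sF.
(* Translation by [m] moves points by [absz m], so a window enlarged by that amount still covers
   [window K] afterwards. *)
have shift_in S K K' : (K + absz m <= K')%N -> uniq S -> {subset window K' <= S} ->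
    uniq [seq m + k | k <- S] /\ {subset window K <= [seq m + k | k <- S]}.
  move=> KK uS KS; split; first by rewrite map_inj_uniq //; apply: addrI.
  move=> k; rewrite mem_window => kK; apply/mapP; exists (k - m); last by lia.
  by apply: KS; rewrite mem_window; lia.
apply: csumZ_eq => e e0; have [K tK] := sF _ e0; exists (K + absz m)%N.
  move=> T uT TK; rewrite -(big_map (+%R m) xpredT F); apply: tK.
    by rewrite map_inj_uniq //; apply: addrI.
  move=> _ /mapP[k /TK kT ->]; move: kT; rewrite !mem_window; lia.
move=> S uS KS; rewrite -(big_map (+%R m) xpredT F).
have [uS' KS'] := shift_in _ K _ (leqnn _) uS KS.
exact: csumZ_approx sF tK uS' KS'.
Qed.

(** [U] bounds the square of the l^2 norm; finite partial sums avoid any appeal to an infinite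
    sum. *)
Definition l2_le (U : C) (u : int -> C) : Prop :=
  forall S, uniq S -> \sum_(k <- S) `|u k| ^+ 2 <= U.

Lemma l2_le_ge0 U u : l2_le U u -> 0 <= U.
Proof. by move=> /(_ [::] isT); rewrite big_nil. Qed.

Lemma l2_le_shift U u m : l2_le U u -> l2_le U (fun k => u (m + k)).
Proof.
move=> lu S uS; rewrite -(big_map (+%R m) xpredT (fun k => `|u k| ^+ 2)).
by apply: lu; rewrite map_inj_uniq //; apply: addrI.
Qed.

(** Otherwise every window misses a finite set of mass more than [e]. Collecting such sets, pairwise
    disjoint, gives mass at least [n e] for every [n], which exceeds [U] by the Archimedean
    property. *)
Lemma l2_tail U u : l2_le U u -> forall e, 0 < e ->
  exists K, small_tail (fun k => `|u k| ^+ 2) K e.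
Proof.
move=> lu e e0; apply: contrapT => /forallNP nK.
have big n : exists2 S, uniq S & e *+ n <= \sum_(k <- S) `|u k| ^+ 2.
  elim: n => [|n [S uS Sn]]; first by exists [::]; rewrite ?big_nil.
  have [K SK] := sub_window S.
  have /existsNP[T /not_implyP[uT /not_implyP[TK]]] := nK K.
  have T0 : 0 <= \sum_(k <- T) `|u k| ^+ 2 by apply: sumr_ge0 => i _; apply: exprn_ge0.
  rewrite ger0_norm // => /negP; rewrite -real_ltNge ?(gtr0_real e0) ?(ger0_real T0) // => Te.
  exists (S ++ T).
    rewrite cat_uniq uS uT andbT /=; apply/hasPn => k /TK; apply: contra; exact: SK.
  by rewrite big_cat mulrSr /= lerD // ltW.
have [d d0 de] := complex_gt0 e0.
have U0 := l2_le_ge0 lu.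
have [r Ur] : exists r : R, U = r%:C.
  by exists (Re U); rewrite RRe_real // ger0_real.
have r0 : 0 <= r by rewrite -lecR -Ur.
have [S uS] := big (Num.bound (r / d)).
move/le_trans/(_ (lu _ uS)); rewrite Ur de -rmorphMn lecR /= leNgt => /negP; apply.
rewrite -mulr_natl -ltr_pdivrMr //.
by apply: archi_boundP; rewrite ?divr_ge0 // ltW.
Qed.

(* AM-GM [|u v| <= t |u|^2 + |v|^2 / t] with a large [t] makes the tail small
   independently of [v]. *)
Lemma l2_mul_tail U u (V : C) : l2_le U u -> forall e, 0 < e ->
  exists K, forall v, l2_le V v -> small_tail (fun k => u k * v k) K e.
Proof.
move=> lu e e0.
case: (pselect (0 <= V)) => [V0|nV]; last first.
  by exists 0%N => v /l2_le_ge0.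
pose t := 2 * (V + 1) / e.
have V1 : 0 < V + 1 by rewrite ltr_wpDl.
have t0 : 0 < t by rewrite divr_gt0 // mulr_gt0.
have [|K tK] := l2_tail lu (e := e / 2 / t); first by rewrite divr_gt0 // divr_gt0.
exists K => v lv T uT TK.
apply: (@le_trans _ _ (\sum_(k <- T) (t * `|u k| ^+ 2 + t^-1 * `|v k| ^+ 2))).
  apply: le_trans (ler_norm_sum _ _ _) _; apply: ler_sum => k _; rewrite normrM.
  by apply: mul_le_weighted_squares.
rewrite big_split /= -!mulr_sumr (splitr e); apply: lerD.
  have := tK _ uT TK; rewrite ger0_norm; last first.
    by apply: sumr_ge0 => i _; apply: exprn_ge0.
  by rewrite ler_pdivlMr // mulrC.
apply: le_trans (ler_wpM2l _ (lv _ uT)) _; first by rewrite invr_ge0 ltW.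
rewrite mulrC ler_pdivrMr // /t.
have en0 : e != 0 by rewrite gt_eqF.
have -> : e / 2 * (2 * (V + 1) / e) = V + 1 by field.
by rewrite lerDl.
Qed.

Lemma l2_summable U u V v : l2_le U u -> l2_le V v -> summable_Z (fun k => u k * v k).
Proof.
move=> lu lv e /(l2_mul_tail V lu)[K tK]; exists K; exact: tK.
Qed.

End Summation.

(** * Bounded matrices through finite sesquilinear forms, and their rows and columns *)

Section Operators.
Variable R : realType.
Local Notation C := R[i].

Lemma l2_mul_approx U V (u : int -> C) : l2_le U u -> forall e, 0 < e ->
  exists K, forall v, l2_le V v ->
    `|\sum_(k <- window K) u k * v k - csumZ (fun k => u k * v k)| <= e.
Proof.
move=> lu e e0; have [K tK] := l2_mul_tail V lu e0; exists K => v lv.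
exact: csumZ_approx (l2_summable lu lv) (tK v lv) (uniq_window K) _.
Qed.

(** The extra 1 is the error of replacing the series by a partial sum. The bound is crude, but
    depends on [U] and [V] alone. *)
Lemma norm_csumZ_le U V (u v : int -> C) : l2_le U u -> l2_le V v ->
  `|csumZ (fun k => u k * v k)| <= U + V + 1.
Proof.
move=> lu lv; have [K cK] := l2_mul_approx V lu ltr01.
rewrite -[csumZ _](subrK (\sum_(k <- window K) u k * v k)) addrC.
apply: le_trans (ler_normD _ _) _; apply: lerD; last by rewrite distrC; apply: cK.
apply: le_trans (ler_norm_sum _ _ _) _.
apply: le_trans (_ : _ <= \sum_(k <- window K) (`|u k| ^+ 2 + `|v k| ^+ 2)) _.
  apply: ler_sum => k _; rewrite normrM.
  by have := @mul_le_weighted_squares C 1 `|u k| `|v k|; rewrite invr1 !mul1r; apply.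
by rewrite big_split lerD ?lu ?lv ?uniq_window.
Qed.

Lemma norm_le_sqr (z U : C) : `|z| ^+ 2 <= U -> `|z| <= U + 1.
Proof.
move=> zU; have := @mul_le_weighted_squares C 1 `|z| 1; rewrite invr1 expr1n mulr1 !mul1r.
by move=> /(_ ltr01 (normr_ge0 z) ler01) /le_trans; apply; rewrite lerD2r.
Qed.

(** Testing against [x := v] gives [s ^+ 2 <= V * s] for the partial sum [s], and a nonzero [s]
    cancels. *)
Lemma l2_le_dual V (v : int -> C) : 0 <= V ->
  (forall S (x : int -> C), uniq S ->
     `|\sum_(k <- S) (x k)^* * v k| ^+ 2 <= V * \sum_(k <- S) `|x k| ^+ 2) ->
  l2_le V v.
Proof.
move=> V0 dv S uS; have := dv S v uS.
under eq_bigr => k _ do rewrite -normCKC.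
have : 0 <= \sum_(k <- S) `|v k| ^+ 2 by apply: sumr_ge0 => k _; apply: exprn_ge0.
move: (\sum_(k <- S) _) => s; rewrite le0r => /predU1P[->//|s0].
by rewrite (ger0_norm (ltW s0)) expr2 ler_pM2r.
Qed.

(** Arbitrary finite sets replace the symmetric windows of [inner]: a translate of a window is not a
    window, and singletons serve as basis vectors. *)
Definition qform (S T : seq int) (x : seqZ R) (A : op R) (y : seqZ R) : C :=
  \sum_(i <- S) \sum_(j <- T) (x i)^* * A i j * y j.

Definition restr (S : seq int) (x : seqZ R) : seqZ R :=
  fun k => if k \in S then x k else 0.

Lemma inner_qform N x (A : op R) y : inner N x A y = qform (window N) (window N) x A y.
Proof. by rewrite /inner wsumE; apply: eq_bigr => i _; rewrite wsumE. Qed.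

Lemma inner_restr N S T x A y : uniq S -> uniq T ->
  {subset S <= window N} -> {subset T <= window N} ->
  inner N (restr S x) A (restr T y) = qform S T x A y.
Proof.
move=> uS uT SN TN; rewrite inner_qform /qform.
rewrite -[RHS](big_sub_uniq _ uS (uniq_window N) SN); apply: eq_bigr => i _.
rewrite /restr; case: ifP => iS; last by rewrite big1 // => j _; rewrite rmorph0 !mul0r.
rewrite -[RHS](big_sub_uniq _ uT (uniq_window N) TN); apply: eq_bigr => j _.
by case: ifP => // _; rewrite mulr0.
Qed.

Lemma nrm2_restr N S x : uniq S -> {subset S <= window N} ->
  nrm2 N (restr S x) = \sum_(k <- S) `|x k| ^+ 2.
Proof.
move=> uS SN; rewrite /nrm2 wsumE -(big_sub_uniq _ uS (uniq_window N) SN).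
by apply: eq_bigr => i _; rewrite /restr; case: ifP; rewrite ?mulr0 // -normCKC.
Qed.

Definition qform_le (V : C) (A : op R) : Prop :=
  0 <= V /\ forall S T x y, uniq S -> uniq T ->
    `|qform S T x A y| ^+ 2 <= V * (\sum_(i <- S) `|x i| ^+ 2) * \sum_(j <- T) `|y j| ^+ 2.

Lemma bounded_qform A : bounded_op A -> exists V, qform_le V A.
Proof.
move=> [V bV]; exists V.
have qV S T x y : uniq S -> uniq T ->
    `|qform S T x A y| ^+ 2 <= V * (\sum_(i <- S) `|x i| ^+ 2) * \sum_(j <- T) `|y j| ^+ 2.
  move=> uS uT; have [N1 SN] := sub_window S; have [N2 TN] := sub_window T.
  have {}SN : {subset S <= window (maxn N1 N2)} by move=> k /SN; apply: sub_windows; lia.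
  have {}TN : {subset T <= window (maxn N1 N2)} by move=> k /TN; apply: sub_windows; lia.
  by have := bV (maxn N1 N2) (restr S x) (restr T y); rewrite inner_restr // !nrm2_restr //.
(* Testing on the basis vector at 0 bounds a square by [V], so [V] is nonnegative. *)
split=> //; have := qV [:: 0] [:: 0] (fun=> 1) (fun=> 1) isT isT.
by rewrite !big_seq1 normr1 expr1n !mulr1; apply: le_trans; apply: exprn_ge0.
Qed.

Lemma qform_le_col V A j : qform_le V A -> l2_le V (A ^~ j).
Proof.
move=> [V0 qV]; apply: l2_le_dual => // S x uS.
have := qV S [:: j] x (fun=> 1) uS isT; rewrite big_seq1 normr1 expr1n mulr1.
by congr (`|_| ^+ 2 <= _); apply: eq_bigr => i _; rewrite big_seq1 mulr1.
Qed.

Lemma qform_le_row V A i : qform_le V A -> l2_le V (A i).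
Proof.
move=> [V0 qV]; apply: l2_le_dual => // S x uS.
have := qV [:: i] S (fun=> 1) (fun k => (x k)^*) isT uS.
rewrite big_seq1 normr1 expr1n mulr1 /qform big_seq1.
under eq_bigr do rewrite rmorph1 mul1r mulrC.
by under [X in _ * X]eq_bigr do rewrite norm_conjC.
Qed.

Definition entry_bounded (A : op R) : Prop := exists c : C, forall i j, `|A i j| <= c.

Lemma col_entry_bounded V (A : op R) : (forall j, l2_le V (A ^~ j)) -> entry_bounded A.
Proof.
move=> cA; exists (V + 1) => i j; apply: norm_le_sqr.
by have := cA j [:: i] isT; rewrite big_seq1.
Qed.

Lemma row_entry_bounded V (A : op R) : (forall i, l2_le V (A i)) -> entry_bounded A.
Proof.
move=> rA; exists (V + 1) => i j; apply: norm_le_sqr.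
by have := rA i [:: j] isT; rewrite big_seq1.
Qed.

Lemma bounded_op_entry A : bounded_op A -> entry_bounded A.
Proof.
by move=> /bounded_qform[V qV]; apply: (@col_entry_bounded V) => j; apply: qform_le_col.
Qed.

Lemma mul_entry_bounded U V (A B : op R) : (forall i, l2_le U (A i)) ->
  (forall j, l2_le V (B ^~ j)) -> entry_bounded (mul_op A B).
Proof. by move=> rA cB; exists (U + V + 1) => i j; apply: norm_csumZ_le. Qed.

(** Column [j] of the product is [A] applied to column [j] of [B], so its squared norm is at most
    [U * V]. By duality it is paired with a finite vector. The inner series is then truncated to a
    window that serves all rows of [A] at once, and the truncated form obeys the bound of [A]. *)
Lemma mul_op_col U V (A B : op R) : qform_le U A -> (forall j, l2_le V (B ^~ j)) ->
  forall j, l2_le (U * V) (mul_op A B ^~ j).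
Proof.
move=> qA cB j; have [U0 qU] := qA; have V0 := l2_le_ge0 (cB j).
apply: l2_le_dual => [|S x uS]; first exact: mulr_ge0.
set b := \sum_(k <- S) _; set n := \sum_(k <- S) _.
have n0 : 0 <= n by apply: sumr_ge0 => k _; apply: exprn_ge0.
have UVn : 0 <= U * V * n by rewrite !mulr_ge0.
suff : `|b| <= sqrtC (U * V * n).
  by rewrite -(ler_pXn2r (n := 2)) ?nnegrE ?sqrtC_ge0 // sqrtCK.
apply/ler_addgt0Pr => e e0.
(* The truncation error in row [k] is weighted by [|x k|], hence totals at most
   [a * (e / (a + 1)) <= e]; the added 1 keeps the divisor positive. *)
pose a := \sum_(k <- S) `|x k|.
have a0 : 0 <= a by apply: sumr_ge0.
have a1 : 0 < a + 1 by rewrite ltr_wpDl.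
have [|K cK] := l2_mul_approx U (cB j) (e := e / (a + 1)); first exact: divr_gt0.
rewrite -[b](subrK (qform S (window K) x A (B ^~ j))) addrC.
apply: le_trans (ler_normD _ _) _; apply: lerD.
  rewrite -(ler_pXn2r (n := 2)) ?nnegrE ?sqrtC_ge0 // sqrtCK.
  apply: le_trans (qU _ _ _ _ uS (uniq_window K)) _.
  rewrite -[leRHS]mulrAC; apply: ler_wpM2l; first exact: mulr_ge0.
  by apply: cB; apply: uniq_window.
rewrite /qform -sumrB; apply: le_trans (ler_norm_sum _ _ _) _.
apply: le_trans (_ : _ <= a * (e / (a + 1))) _; last first.
  by rewrite mulrCA ger_pMr // ler_pdivrMr // mul1r lerDl.
rewrite mulr_suml; apply: ler_sum => k _.
under eq_bigr do rewrite -mulrA.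
rewrite -mulr_sumr -mulrBr normrM norm_conjC; apply: ler_wpM2l => //.
rewrite distrC; have := cK _ (qform_le_row k qA); congr (`|_ - _| <= _).
  by apply: eq_bigr => l _; rewrite mulrC.
by congr csumZ; apply: funext => l; rewrite mulrC.
Qed.

End Operators.

(** * States on bounded sequences, and their interchange with l^2 series *)

Section BoundedFunctional.
Variable R : realType.
Local Notation C := R[i].

Lemma bounded_seq_cst (c : C) : bounded_seq (fun=> c).
Proof. by exists `|c|. Qed.

Lemma bounded_add_seq a (d e : seqZ R) :
  bounded_seq d -> bounded_seq e -> bounded_seq (add_seq a d e).
Proof.
move=> [c dc] [c' ec]; exists (`|a| * c + c') => i.
by rewrite (le_trans (ler_normD _ _)) // normrM lerD ?ler_wpM2l.
Qed.

Lemma bounded_seqZ a (d : seqZ R) : bounded_seq d -> bounded_seq (fun m => a * d m).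
Proof. by move=> [c dc]; exists (`|a| * c) => i; rewrite normrM ler_wpM2l. Qed.

Lemma bounded_seqD (d e : seqZ R) :
  bounded_seq d -> bounded_seq e -> bounded_seq (fun m => d m + e m).
Proof.
by move=> [c dc] [c' ec]; exists (c + c') => i; rewrite (le_trans (ler_normD _ _)) ?lerD.
Qed.

Lemma bounded_seq_sum (I : Type) (S : seq I) (F : I -> seqZ R) :
  (forall k, bounded_seq (F k)) -> bounded_seq (fun m => \sum_(k <- S) F k m).
Proof.
move=> bF; elim: S => [|k S IH].
  by exists 0 => i; rewrite big_nil normr0.
have [c kc] := bounded_seqD (bF k) IH.
by exists c => i; rewrite big_cons; apply: kc.
Qed.

Definition state (phi : seqZ R -> C) : Prop :=
  [/\ forall a d e, bounded_seq d -> bounded_seq e ->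
        phi (add_seq a d e) = a * phi d + phi e,
      forall d, bounded_seq d -> (forall i, 0 <= d i) -> 0 <= phi d &
      phi (@one_seq R) = 1].

Variable phi : seqZ R -> C.
Hypothesis phiS : state phi.

Lemma state_lin a d e : bounded_seq d -> bounded_seq e ->
  phi (fun m => a * d m + e m) = a * phi d + phi e.
Proof. by case: phiS => + _ _; apply. Qed.

Lemma state0 : phi (fun=> 0) = 0.
Proof.
have b0 := bounded_seq_cst 0.
have := state_lin 1 b0 b0; rewrite mul1r addr0 mul1r => /eqP.
by rewrite -subr_eq0 opprD addNKr oppr_eq0 => /eqP.
Qed.

Lemma stateZ a d : bounded_seq d -> phi (fun m => a * d m) = a * phi d.
Proof.
move=> bd; have := state_lin a bd (bounded_seq_cst 0); rewrite state0 addr0 => <-.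
by congr phi; apply: funext => m; rewrite addr0.
Qed.

Lemma stateB d e : bounded_seq d -> bounded_seq e ->
  phi (fun m => d m - e m) = phi d - phi e.
Proof.
move=> bd be; have := state_lin (-1) be bd; rewrite mulN1r addrC => <-.
by congr phi; apply: funext => m; rewrite mulN1r addrC.
Qed.

Lemma state_sum (I : Type) (S : seq I) (F : I -> seqZ R) :
  (forall k, bounded_seq (F k)) ->
  phi (fun m => \sum_(k <- S) F k m) = \sum_(k <- S) phi (F k).
Proof.
move=> bF; elim: S => [|k S IH].
  by rewrite big_nil -[RHS]state0; congr phi; apply: funext => m; rewrite big_nil.
rewrite big_cons -IH -[X in _ = X + _]mul1r -state_lin //; last exact: bounded_seq_sum.
by congr phi; apply: funext => m; rewrite big_cons mul1r.
Qed.

Lemma state_cst c : phi (fun=> c) = c.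
Proof.
have [_ _ phi1] := phiS.
rewrite -[RHS]mulr1 -phi1 -stateZ; last exact: bounded_seq_cst.
by congr phi; apply: funext => m; rewrite mulr1.
Qed.

Lemma state_ge0 d : bounded_seq d -> (forall i, 0 <= d i) -> 0 <= phi d.
Proof. by case: phiS => _ + _; apply. Qed.

(** Positivity is applied to [c - d] and [c + d]; the first also shows that [phi d] is real. *)
Lemma norm_state_real c d : (forall i, `|d i| <= c) -> (forall i, d i \is Num.real) ->
  `|phi d| <= c.
Proof.
move=> dc dr; have bd : bounded_seq d by exists c.
have bc := bounded_seq_cst c.
have dc' i : - c <= d i <= c by rewrite -real_ler_norml.
have le1 : 0 <= phi (fun m => c - d m).
  apply: state_ge0 => [|i]; last by rewrite subr_ge0; case/andP: (dc' i).
  have [b] := bounded_add_seq (-1) bd bc.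
  by rewrite /add_seq => h; exists b => i; rewrite addrC -mulN1r.
have le2 : 0 <= phi (fun m => 1 * d m + c).
  apply: state_ge0 => [|i]; last by rewrite mul1r -[c]opprK subr_ge0; case/andP: (dc' i).
  exact (bounded_add_seq 1 bd bc).
rewrite stateB // state_cst subr_ge0 in le1.
rewrite state_lin // state_cst mul1r -[c]opprK subr_ge0 in le2.
have c0 : 0 <= c := le_trans (normr_ge0 (d 0)) (dc 0).
rewrite real_ler_norml ?le2 //.
by rewrite -(subKr c (phi d)) rpredB ?ger0_real ?subr_ge0.
Qed.

(** The factor 2 comes from treating real and imaginary parts separately. *)
Lemma norm_state_le c d : (forall i, `|d i| <= c) -> `|phi d| <= 2 * c.
Proof.
move=> dc.
have reR (z : C) : `|'Re z| <= `|z| by rewrite leif_normC_Re_Creal.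
have imR (z : C) : `|'Im z| <= `|z|.
  by rewrite -normrN -ReMil (le_trans (reR _)) // normrM normCi mul1r.
have reC i : `|'Re (d i)| <= c := le_trans (reR _) (dc i).
have imC i : `|'Im (d i)| <= c := le_trans (imR _) (dc i).
have -> : phi d = 'i * phi (fun m => 'Im (d m)) + phi (fun m => 'Re (d m)).
  rewrite -state_lin; [|by exists c..].
  by congr phi; apply: funext => m; rewrite addrC -Crect.
rewrite mulr2n mulrDl mul1r (le_trans (ler_normD _ _)) // normrM normCi mul1r.
by apply: lerD; apply: norm_state_real => // i; rewrite ?Creal_Im ?Creal_Re.
Qed.

(** [phi] commutes with finite sums. Since [l2_mul_tail] chooses its window before [v], the tails
    are small uniformly in [m], and [norm_state_le] carries this smallness through [phi]. *)
Lemma state_csumZ U V (u : int -> C) (v : int -> int -> C) :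
  l2_le U u -> (forall m, l2_le V (v m)) ->
  phi (fun m => csumZ (fun k => u k * v m k)) =
  csumZ (fun k => u k * phi (fun m => v m k)).
Proof.
move=> lu lv.
have bv k : bounded_seq (fun m => v m k).
  by exists (V + 1) => m; apply: norm_le_sqr; have := lv m [:: k] isT; rewrite big_seq1.
have buv k : bounded_seq (fun m => u k * v m k) by apply: bounded_seqZ.
have phiE S : \sum_(k <- S) u k * phi (fun m => v m k) =
    phi (fun m => \sum_(k <- S) u k * v m k).
  by rewrite state_sum //; apply: eq_bigr => k _; rewrite stateZ.
have unif e : 0 < e -> exists K, forall m, small_tail (fun k => u k * v m k) K (e / 2).
  move=> e0; have [|K tK] := l2_mul_tail V lu (e := e / 2); first exact: divr_gt0.
  by exists K => m; apply: tK.
have half (e : C) : 2 * (e / 2) = e by rewrite mulrC divfK.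
(* One window gives both summability of the right-hand series and its limit: either error is [phi]
   of a sequence bounded by [e / 2], and the halving absorbs the factor 2 of [norm_state_le]. *)
apply/esym/csumZ_eq => e e0; have [K tK] := unif e e0; exists K.
  move=> T uT TK; rewrite phiE -[e]half; apply: norm_state_le => m; exact: tK.
move=> S uS KS; rewrite phiE -[e]half -stateB.
- apply: norm_state_le => m.
  exact: csumZ_approx (l2_summable lu (lv m)) (tK m) uS KS.
- exact: bounded_seq_sum.
- by exists (U + V + 1) => m; apply: norm_csumZ_le.
Qed.

End BoundedFunctional.

(** * Shift equivariance and the extension of [Phi] to all matrices *)

Lemma step_invariant (T : Type) (f : int -> T) :
  (forall m, f (m + 1) = f m) -> forall m, f m = f 0.
Proof.
move=> f1; elim=> [//|n IH|n IH]; first by rewrite -IH -[RHS]f1; congr f; lia.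
by rewrite -IH -[LHS]f1; congr f; lia.
Qed.

Section ShiftEquivariant.
Variable R : realType.
Local Notation C := R[i].

Definition shift_op (m : int) (A : op R) : op R := fun i j => A (m + i) (m + j).

Lemma laurent_shift (L : op R) m : laurent L -> shift_op m L = L.
Proof.
move=> [_ L1]; apply: funext => i; apply: funext => j.
pose f k := shift_op k L i j.
have /(_ m) : forall k, f k = f 0.
  apply: step_invariant => k; rewrite /f /shift_op -[RHS]L1; congr L; lia.
by rewrite /f /shift_op !add0r.
Qed.

Lemma qform_shift S T x m (A : op R) y :
  qform S T x (shift_op m A) y =
  qform [seq m + k | k <- S] [seq m + k | k <- T]
    (fun k => x (k - m)) A (fun k => y (k - m)).
Proof.
rewrite /qform big_map; apply: eq_bigr => i _; rewrite big_map; apply: eq_bigr => j _.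
by rewrite ![m + _ - m]addrAC !subrr !add0r.
Qed.

Lemma qform_le_shift V m (A : op R) : qform_le V A -> qform_le V (shift_op m A).
Proof.
move=> [V0 qV]; split=> // S T x y uS uT; rewrite qform_shift.
have um (Q : seq int) : uniq Q -> uniq [seq m + k | k <- Q].
  by move=> uQ; rewrite map_inj_uniq //; apply: addrI.
have sum_shift (Q : seq int) (z : seqZ R) :
    \sum_(k <- [seq m + k | k <- Q]) `|z (k - m)| ^+ 2 = \sum_(k <- Q) `|z k| ^+ 2.
  by rewrite big_map; apply: eq_bigr => k _; rewrite addrAC subrr add0r.
by rewrite -(sum_shift S x) -(sum_shift T y); apply: qV; apply: um.
Qed.

(** The translated window is embedded in a larger symmetric one, and the translated vectors are
    extended by zero. *)
Lemma block_pos_shift n m (A : 'I_n -> 'I_n -> op R) : block_pos A ->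
  block_pos (fun k l => shift_op m (A k l)).
Proof.
move=> posA N x.
have uW : uniq [seq m + k | k <- window N].
  by rewrite map_inj_uniq ?uniq_window //; apply: addrI.
have [K WK] := sub_window [seq m + k | k <- window N].
have := posA K (fun k => restr [seq m + k | k <- window N] (fun i => x k (i - m))).
congr (0 <= _); apply: eq_bigr => k _; apply: eq_bigr => l _.
by rewrite inner_restr // inner_qform qform_shift.
Qed.

Variable Phi : seqZ R -> seqZ R.
Hypothesis ucpPhi : ucp_diag Phi.
Hypothesis PhiB : forall d, bounded_seq d -> Phi (conjB d) = conjB (Phi d).

(** Equivariance makes [Phi (d (. + k)) (i - k)] independent of [k]; compare [k = 0] with
    [k = i]. *)
Lemma Phi_shift d i : bounded_seq d -> Phi d i = Phi (fun m => d (m + i)) 0.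
Proof.
move=> [c dc].
pose f k := Phi (fun m => d (m + k)) (i - k).
have fc : forall k, f k = f 0.
  apply: step_invariant => k; rewrite /f.
  have bd : bounded_seq (fun m => d (m + (k + 1))) by exists c.
  have -> : (fun m => d (m + k)) = conjB (fun m => d (m + (k + 1))).
    by apply: funext => m; rewrite /conjB; congr d; lia.
  by rewrite PhiB // /conjB; congr (Phi _ _); lia.
transitivity (f 0); last by rewrite -(fc i) /f subrr.
by rewrite /f subr0; congr (Phi _ _); apply: funext => m; rewrite addr0.
Qed.

Lemma diag_block_pos (d : seqZ R) : (forall i, 0 <= d i) ->
  block_pos (fun k l : 'I_1 => diag d).
Proof.
move=> d0 N x; rewrite !big_ord1 inner_qform; apply: sumr_ge0 => i _; apply: sumr_ge0 => j _.
rewrite /diag; case: eqP => [<-|_]; last by rewrite mulr0 mul0r.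
by rewrite mulrAC -normCKC mulr_ge0 // exprn_ge0.
Qed.

Lemma state_Phi : state (fun d => Phi d 0).
Proof.
have [_ lin one pos] := ucpPhi; split=> [a d e bd be|d bd d0|].
- by rewrite lin.
(* Positivity is the case of 1 by 1 blocks; the window of radius 0 with test vector 1 reads off the
   entry at 0. *)
- have := pos 1%N (fun _ _ => d) (fun _ _ => bd) (diag_block_pos d0) 0%N (fun _ _ => 1).
  by rewrite !big_ord1 inner_qform /qform !big_seq1 /= rmorph1 mul1r mulr1 /diag eqxx.
- by rewrite one.
Qed.

(** Entry [(i, j)] lies on diagonal [i - j], so the matrix is assembled directly from its prescribed
    Fourier coefficients. *)
Definition extend (A : op R) : op R := fun i j => Phi (fourier A (i - j)) i.

Lemma bounded_fourier n (A : op R) : entry_bounded A -> bounded_seq (fourier A n).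
Proof. by move=> [c cA]; exists c => i; apply: cA. Qed.

Lemma fourier_extend A n : fourier (extend A) n = Phi (fourier A n).
Proof. by apply: funext => i; rewrite /fourier /extend subKr. Qed.

Lemma extendE A i j : entry_bounded A ->
  extend A i j = Phi (fun m => shift_op m A i j) 0.
Proof.
move=> bA; rewrite /extend Phi_shift; last exact: bounded_fourier.
by congr (Phi _ 0); apply: funext => m; rewrite /fourier /shift_op; congr A; lia.
Qed.

(** Bounds on rows of [L] and columns of [A] are the form in which [mul_op_col] makes this
    applicable to a product [mul_op A M]. *)
Lemma extend_mulL U V (L A : op R) : laurent L -> (forall i, l2_le U (L i)) ->
  (forall j, l2_le V (A ^~ j)) -> extend (mul_op L A) = mul_op L (extend A).
Proof.
move=> lL rL cA; apply: funext => i; apply: funext => j.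
rewrite extendE; last exact: mul_entry_bounded rL cA.
have cA' m : l2_le V (fun k => shift_op m A k j) by apply: l2_le_shift (cA (m + j)).
(* Conjugating the product by the shift conjugates each factor, after translating the summation
   index; [L] is unchanged by this. *)
have -> : (fun m => shift_op m (mul_op L A) i j) =
    fun m => csumZ (fun k => L i k * shift_op m A k j).
  apply: funext => m; rewrite /shift_op /mul_op.
  rewrite -(csumZ_shift m (l2_summable (rL (m + i)) (cA (m + j)))).
  congr csumZ; apply: funext => k; congr (_ * _).
  by rewrite -[in RHS](laurent_shift m lL).
rewrite (state_csumZ state_Phi (rL i) cA') /mul_op.
congr csumZ; apply: funext => k; rewrite extendE //; exact: col_entry_bounded cA.
Qed.

(** Here the fixed l^2 sequence is a column of [M], while the row of [A] varies with [m]. *)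
Lemma extend_mulR U V (A M : op R) : laurent M -> (forall i, l2_le U (A i)) ->
  (forall j, l2_le V (M ^~ j)) -> extend (mul_op A M) = mul_op (extend A) M.
Proof.
move=> lM rA cM; apply: funext => i; apply: funext => j.
rewrite extendE; last exact: mul_entry_bounded rA cM.
have rA' m : l2_le U (shift_op m A i) by apply: l2_le_shift (rA (m + i)).
have -> : (fun m => shift_op m (mul_op A M) i j) =
    fun m => csumZ (fun k => M k j * shift_op m A i k).
  apply: funext => m; rewrite /shift_op /mul_op.
  rewrite -(csumZ_shift m (l2_summable (rA (m + i)) (cM (m + j)))).
  congr csumZ; apply: funext => k; rewrite mulrC; congr (_ * _).
  by rewrite -[in RHS](laurent_shift m lM).
rewrite (state_csumZ state_Phi (cM j) rA') /mul_op.
congr csumZ; apply: funext => k; rewrite mulrC extendE //; exact: row_entry_bounded rA.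
Qed.

Lemma qform_extend S T x (A : op R) y : entry_bounded A ->
  qform S T x (extend A) y = Phi (fun m => qform S T x (shift_op m A) y) 0 /\
  bounded_seq (fun m => qform S T x (shift_op m A) y).
Proof.
move=> bA; have [c cA] := bA.
have bij i j : bounded_seq (fun m => (x i)^* * y j * shift_op m A i j).
  by apply: bounded_seqZ; exists c => m; apply: cA.
have -> : (fun m => qform S T x (shift_op m A) y) =
    fun m => \sum_(i <- S) \sum_(j <- T) (x i)^* * y j * shift_op m A i j.
  apply: funext => m; apply: eq_bigr => i _; apply: eq_bigr => j _; exact: mulrAC.
have bi i : bounded_seq (fun m => \sum_(j <- T) (x i)^* * y j * shift_op m A i j).
  exact: (@bounded_seq_sum R int T (fun j m => (x i)^* * y j * shift_op m A i j)).
split; last exact: (@bounded_seq_sum R int S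
  (fun i m => \sum_(j <- T) (x i)^* * y j * shift_op m A i j)).
rewrite (state_sum state_Phi S bi); apply: eq_bigr => i _.
rewrite (state_sum state_Phi T (bij i)); apply: eq_bigr => j _.
rewrite (stateZ state_Phi); last by exists c => m; apply: cA.
by rewrite -extendE // mulrAC.
Qed.

Lemma bounded_extend A : bounded_op A -> bounded_op (extend A).
Proof.
(* [V] bounds a squared norm, so the factor 2 of [norm_state_le] enters as 4. *)
move=> bA; have [V qV] := bounded_qform bA; exists (4 * V) => N x y.
have uW := uniq_window N.
have [V0 _] := qV.
have bE := bounded_op_entry bA.
rewrite inner_qform (qform_extend _ _ _ _ bE).1 /nrm2 !wsumE.
under [X in _ <= _ * X * _]eq_bigr do rewrite -normCKC.
under [X in _ <= _ * X]eq_bigr do rewrite -normCKC.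
set Q := _ * _ * _.
have n0 (z : seqZ R) : 0 <= \sum_(k <- window N) `|z k| ^+ 2.
  by apply: sumr_ge0 => k _; apply: exprn_ge0.
pose c := sqrtC (V * (\sum_(i <- window N) `|x i| ^+ 2) * (\sum_(i <- window N) `|y i| ^+ 2)).
have c0 : 0 <= c by rewrite sqrtC_ge0 !mulr_ge0.
have -> : Q = (2 * c) ^+ 2 by rewrite exprMn sqrtCK /Q !mulrA -natrX.
rewrite ler_pXn2r ?nnegrE ?mulr_ge0 //.
apply: (norm_state_le state_Phi) => m.
rewrite -(ler_pXn2r (n := 2)) ?nnegrE // sqrtCK.
by have [_] := qform_le_shift m qV; apply.
Qed.

(** The block form of the extension is the state evaluated at the block forms of the shifted
    matrices, each nonnegative by [block_pos_shift]. *)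
Lemma extend_block_pos n (A : 'I_n -> 'I_n -> op R) :
  (forall k l, bounded_op (A k l)) -> block_pos A ->
  block_pos (fun k l => extend (A k l)).
Proof.
move=> bA posA N x.
pose W := window N.
pose q k l m := qform W W (x k) (shift_op m (A k l)) (x l).
have qE k l : inner N (x k) (extend (A k l)) (x l) = Phi (q k l) 0 /\ bounded_seq (q k l).
  by rewrite inner_qform; apply: qform_extend; apply: bounded_op_entry.
have bq k : bounded_seq (fun m => \sum_(l < n) q k l m).
  by apply: bounded_seq_sum => l; apply: (qE k l).2.
have -> : \sum_(k < n) \sum_(l < n) inner N (x k) (extend (A k l)) (x l) =
    Phi (fun m => \sum_(k < n) \sum_(l < n) q k l m) 0.
  rewrite (state_sum state_Phi _ bq); apply: eq_bigr => k _.
  rewrite (state_sum state_Phi _ (fun l => (qE k l).2)); apply: eq_bigr => l _.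
  exact: (qE k l).1.
apply: (state_ge0 state_Phi) => [|m]; first exact: bounded_seq_sum bq.
have := block_pos_shift m posA N x; congr (0 <= _).
by apply: eq_bigr => k _; apply: eq_bigr => l _; rewrite inner_qform.
Qed.

Lemma extend_id : extend (@id_op R) = @id_op R.
Proof.
apply: funext => i; apply: funext => j.
have bE : entry_bounded (@id_op R).
  by exists 1 => k l; rewrite /id_op; case: eqP => _; rewrite ?normr1 ?normr0.
rewrite extendE // -[RHS](state_cst state_Phi); congr (Phi _ 0).
by apply: funext => m; rewrite /shift_op /id_op (inj_eq (addrI m)).
Qed.

Lemma ucp_extend : ucp_op extend.
Proof.
split; [exact: bounded_extend | | exact: extend_id | exact: extend_block_pos].
move=> a A B bA bB; apply: funext => i; apply: funext => j.
have [_ lin _ _] := ucpPhi.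
have := lin a (fourier A (i - j)) (fourier B (i - j)).
move=> /(_ (bounded_fourier _ (bounded_op_entry bA)) (bounded_fourier _ (bounded_op_entry bB))).
by move=> /(congr1 (fun d => d i)).
Qed.

End ShiftEquivariant.

Theorem theorem3p1 (R : realType) (Phi : seqZ R -> seqZ R) :
  ucp_diag Phi ->
  (forall d, bounded_seq d -> Phi (conjB d) = conjB (Phi d)) ->
  exists Gamma : op R -> op R,
    [/\ ucp_op Gamma,
        (forall L A M, laurent L -> bounded_op A -> laurent M ->
            Gamma (mul_op L (mul_op A M)) = mul_op L (mul_op (Gamma A) M)),
        (forall A n, bounded_op A -> fourier (Gamma A) n = Phi (fourier A n)) &
        ((forall d, bounded_seq d -> Phi (Phi d) = Phi d) ->
            forall A, bounded_op A -> Gamma (Gamma A) = Gamma A)].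
Proof.
move=> ucpPhi PhiB; exists (extend Phi); split.
- exact: ucp_extend.
- move=> L A M lL bA lM.
  have [U qL] := bounded_qform lL.1.
  have [V qA] := bounded_qform bA.
  have [W qM] := bounded_qform lM.1.
  have cM j := qform_le_col j qM.
  (* [L] comes out first, with [mul_op A M] as the inner matrix and its column bounds from
     [mul_op_col]; [M] comes out next. *)
  rewrite (extend_mulL ucpPhi PhiB lL (fun i => qform_le_row i qL) (mul_op_col qA cM)).
  by rewrite (extend_mulR ucpPhi PhiB lM (fun i => qform_le_row i qA) cM).
- by move=> A n _; apply: fourier_extend.
- move=> idem A bA; apply: funext => i; apply: funext => j.
  by rewrite /extend -/(extend Phi A) fourier_extend idem //; apply/bounded_fourier/bounded_op_entry.
Qed.
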